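(* Fix $j\in N$. For every $S\subseteq N\setminus\{j\}$, the following two inequalities are valid for $\mathcal{B}_j$ (i.e. satisfied by every $(x_j,y_0,\boldsymbol{y})\in\mathcal{B}_j$): $$y_j\ \ge\ \alpha(S\cup\{j\})\,x_j-\sum_{t\in N\setminus(S\cup\{j\})}u_t\,\alpha(S\cup\{j\})\,y_t,$$ $$y_j\ \le\ \alpha(S\cup\{j\})\,x_j+\bigl(1-(u_0+u_j)\,\alpha(S\cup\{j\})\bigr)y_0-\sum_{t\in S}u_t\,\alpha(S\cup\{j\})\,y_t.$$
   Context: $N=\{1,\dots,n\}$; $u_0>0$ and $u_j\ge0$ for $j\in N$ are given. For $S\subseteq N$, $U(S)=u_0+\sum_{i\in S}u_i$ and $\alpha(S)=1/U(S)$. Let $$Y=\Bigl\{(y_0,\boldsymbol{y})\in\mathbb{R}^{n+1}: u_0y_0+\sum_{k\in N}u_ky_k=1,\ 0\le y_k\le y_0\text{ for all }k\in N\Bigr\},$$ and $\mathcal{B}_j=\{(x_j,y_0,\boldsymbol{y})\in\{0,1\}\times Y: y_j=y_0x_j\}$. *)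

(* Defs.v *)
From mathcomp Require Import all_boot all_order all_algebra.
From mathcomp Require Import classical_sets reals.

Set Implicit Arguments.
Unset Strict Implicit.
Unset Printing Implicit Defensive.

Import Order.TTheory GRing.Theory Num.Theory.
Local Open Scope ring_scope.

(* The index set N = {1, ..., n} is 'I_n; the index 0 is kept apart, so that
   u_0 is [u0], y_0 is [y0], and R^{n+1} is [R * 'rV[R]_n]. *)

Definition U (R : realType) (n : nat) (u0 : R) (u : 'I_n -> R)
    (S : {set 'I_n}) : R :=
  u0 + \sum_(i in S) u i.

Definition alpha (R : realType) (n : nat) (u0 : R) (u : 'I_n -> R)
    (S : {set 'I_n}) : R :=
  1 / U u0 u S.

Definition Y (R : realType) (n : nat) (u0 : R) (u : 'I_n -> R) :
    set (R * 'rV[R]_n) :=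
  fun '(y0, y) =>
    u0 * y0 + \sum_(k < n) u k * y 0 k = 1 /\
    forall k : 'I_n, 0 <= y 0 k <= y0.

Definition B (R : realType) (n : nat) (u0 : R) (u : 'I_n -> R) (j : 'I_n) :
    set (R * (R * 'rV[R]_n)) :=
  fun '(xj, (y0, y)) =>
    [/\ xj = 0 \/ xj = 1, Y u0 u (y0, y) & y 0 j = y0 * xj].

(* Main.v *)
Require Import Defs.
From mathcomp Require Import all_boot all_order all_algebra.
From mathcomp Require Import classical_sets reals.
From mathcomp Require Import ring lra.

Import Order.TTheory GRing.Theory Num.Theory.
Local Open Scope ring_scope.

(** Write [W] for the value of [U] at [S :|: [set j]], [V] for the sum of the
    [u t] over [S], and split the normalisation of [Y] as
    [u0 * y0 + u j * y 0 j + P + Q = 1], where [P] and [Q] collect the terms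
    [u t * y 0 t] with [t] in [S] and with [t] outside [S :|: [set j]].

    As the [u t] are nonnegative, the bounds [0 <= y 0 k <= y0] make both
    [V * y0 - P] and [Q] nonnegative.
    Multiplied by [W > 0], the slacks of the two inequalities are these two
    quantities, in one order or the other according to the value of [xj]:
    the first slack is [Q] when [xj = 0] and [V * y0 - P] when [xj = 1], and the
    second slack is the other one.  For [xj = 0] this is because [y 0 j = 0];
    for [xj = 1] because [y 0 j = y0] and the [1] contributed by [xj] is
    replaced by the normalisation of [Y]. *)

Lemma sum_split_insert {V : nmodType} {T : finType} {j : T} {S : {set T}}
    (F : T -> V) : j \notin S ->
  \sum_t F t
    = F j + \sum_(t in S) F t + \sum_(t in [set: T] :\: (S :|: [set j])) F t.
Proof.
move=> jS; rewrite (bigID (mem (S :|: [set j]))) /= finset.setUC big_setU1 //=.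
by congr (_ + _); apply: eq_bigl => t; rewrite !inE andbT.
Qed.

(** Both inequalities of the theorem carry the weight [alpha] on each term of
    their sum; factoring it out reduces them to statements about [P] and [Q]. *)
Lemma sum_weight_out (K : comPzRingType) (T : finType) (A : {set T})
    (u y : T -> K) (a : K) :
  \sum_(t in A) u t * a * y t = a * \sum_(t in A) u t * y t.
Proof. by rewrite mulr_sumr; apply: eq_bigr => t _; rewrite mulrCA mulrA. Qed.

(** What is left once the sums are named: the slacks no longer depend on [n]
    or on the set, so each value of [xj] is a substitution into the
    normalisation followed by linear arithmetic. *)
Lemma scaled_slacks {K : realFieldType} {u0 uj V P Q W xj y0 yj : K} :
  0 < W -> W = u0 + uj + V -> u0 * y0 + uj * yj + P + Q = 1 ->
  0 <= Q -> P <= V * y0 -> xj = 0 \/ xj = 1 -> yj = y0 * xj ->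
  W^-1 * xj - W^-1 * Q <= yj /\
  yj <= W^-1 * xj + (1 - (u0 + uj) * W^-1) * y0 - W^-1 * P.
Proof.
move=> W0 WE norm Q0 PV xE yE.
have Wn0 : W != 0 by rewrite gt_eqF.
have scaled_lower : xj - Q <= W * yj.
  by rewrite yE WE; move: norm; rewrite yE; case: xE => ->; lra.
have scaled_upper : W * yj <= xj + V * y0 - P.
  by rewrite yE WE; move: norm; rewrite yE; case: xE => ->; lra.
split; rewrite -(ler_pM2l W0).
  by rewrite mulrBr !mulVKf.
have -> : W * (W^-1 * xj + (1 - (u0 + uj) * W^-1) * y0 - W^-1 * P)
          = xj + (W - (u0 + uj)) * y0 - P by field.
by have -> : W - (u0 + uj) = V by rewrite WE addrC addKr.
Qed.

Theorem theorem3 (R : realType) (n : nat) (u0 : R) (u : 'I_n -> R)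
    (hu0 : 0 < u0) (hu : forall k : 'I_n, 0 <= u k)
    (j : 'I_n) (S : {set 'I_n}) (hS : S \subset [set: 'I_n] :\ j) :
  forall (xj y0 : R) (y : 'rV[R]_n), B u0 u j (xj, (y0, y)) ->
    (y 0 j >= alpha u0 u (S :|: [set j]) * xj
              - \sum_(t in [set: 'I_n] :\: (S :|: [set j]))
                  u t * alpha u0 u (S :|: [set j]) * y 0 t) /\
    (y 0 j <= alpha u0 u (S :|: [set j]) * xj
              + (1 - (u0 + u j) * alpha u0 u (S :|: [set j])) * y0
              - \sum_(t in S) u t * alpha u0 u (S :|: [set j]) * y 0 t).
Proof.
move=> xj y0 y [xE [norm bnd] yE].
have jS : j \notin S.
  by apply/negP => /(fintype.subsetP hS); rewrite !inE eqxx.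
have WE : U u0 u (S :|: [set j]) = u0 + u j + \sum_(t in S) u t.
  by rewrite /U finset.setUC big_setU1 //= addrA.
have V0 : 0 <= \sum_(t in S) u t by apply: sumr_ge0.
have W0 : 0 < U u0 u (S :|: [set j]).
  by rewrite WE -addrA ltr_pwDl // addr_ge0.
rewrite /alpha div1r !(sum_weight_out _ _ _ u (fun t => y 0 t)).
apply: (scaled_slacks W0 WE) => //.
- by rewrite -norm (sum_split_insert _ jS) !addrA.
- by apply: sumr_ge0 => t _; case/andP: (bnd t) => yt0 _; rewrite mulr_ge0.
- rewrite mulr_suml; apply: ler_sum => t _.
  by case/andP: (bnd t) => _ yt; rewrite ler_wpM2l.
Qed.
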